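(* Let $k\in\mathbb{N}$ and let $A\in\mathbb{R}^{k\times k}$ be a block interaction matrix (symmetric, positive definite). Then the sequence $(\tilde m^{(n)})_{n\in\mathbb{N}}$ satisfies a large deviation principle under $(\mu_{J_n})_{n\in\mathbb{N}}$ with speed $N=N(n)$ and rate function $$J(x) = \sup_{y\in\mathbb{R}^k} I(y) - I(x),$$ where $$I(x) = \frac12\langle x,\Gamma_\infty^2 A\Gamma_\infty^2 x\rangle - \sum_{i=1}^k \gamma_i^2 L^*(x_i),$$ and $L^*$ denotes the convex conjugate of $\log\cosh$, i.e. $L^*(x)=\frac12(1+x)\log(1+x)+\frac12(1-x)\log(1-x)$ for $x\in[-1,1]$.
   Context: Setting (block spin Ising model). Let $k\in\mathbb{N}$ and let $A\in\mathbb{R}^{k\times k}$ be symmetric and positive definite (the block interaction matrix). Let $N=N(n)$ be a strictly increasing sequence in $\mathbb{N}$, and for each $n$ let $B_1^{(n)},\dots,B_k^{(n)}$ be a partition of $\{1,\dots,N\}$ into $k$ (nonempty) blocks, ordered so that $i_0\in B_i^{(n)}$, $j_0\in B_j^{(n)}$, $i<j$ implies $i_0<j_0$. Assume that for each $i$ the limit $\gamma_i=\lim_{n\to\infty}\sqrt{|B_i^{(n)}|/N}\in(0,1)$ exists, and put $\Gamma_\infty=\mathrm{diag}(\gamma_1,\dots,\gamma_k)$. Let $h(a)$ denote the index of the block containing $a\in\{1,\dots,N\}$ and let $J_n\in\mathbb{R}^{N\times N}$ be the matrix with entries $(J_n)_{ab}=\frac1N A_{h(a)h(b)}$. Let $\mu_{J_n}$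 be the probability measure on $\{-1,+1\}^N$ given by $\mu_{J_n}(x)=Z_n^{-1}\exp(\frac12\langle x,J_nx\rangle)$, with $Z_n$ the normalizing constant. Block magnetizations: for $x\in\{-1,+1\}^N$, $\tilde m^{(n)}(x)\in\mathbb{R}^k$ has components $\tilde m^{(n)}_i(x)=\frac{1}{|B_i^{(n)}|}\sum_{j\in B_i^{(n)}}x_j$. Conventions: $0\log 0=0$; as a convex conjugate, $L^*(x)=+\infty$ for $|x|>1$, so $I(x)=-\infty$ and $J(x)=+\infty$ for $x\notin[-1,1]^k$. LDP: a sequence of probability measures $(\nu_n)$ on a Polish space $\mathcal{X}$ satisfies a large deviation principle with speed $a_n$ and rate function $\mathcal{I}$ (a lower semicontinuous function, possibly taking the value $+\infty$, with compact sublevel sets $\{\mathcal{I}\le L\}$, $L>0$) if for all Borel sets $B$, $-\inf_{\mathrm{int}(B)}\mathcal{I}\le\liminf_n\frac{\log\nu_n(B)}{a_n}\le\limsup_n\frac{\log\nu_n(B)}{a_n}\le-\inf_{\mathrm{cl}(B)}\mathcal{I}$. Random variables $X_n$ satisfy an LDP under $\mu_n$ if the push-forwards $\mu_n\circ X_n^{-1}$ do. *)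

(* Defs.v *)
From HB Require Import structures.
From mathcomp Require Import all_boot all_order all_algebra.
From mathcomp Require Import all_classical all_reals all_analysis.

Set Implicit Arguments.
Unset Strict Implicit.
Unset Printing Implicit Defensive.

Import Order.TTheory GRing.Theory Num.Theory.
Import numFieldNormedType.Exports.
Local Open Scope ring_scope.

Notation borel X := (g_sigma_algebraType (@open X)).

Section large_deviations.
Context {R : realType} {X : ptopologicalType}.
Local Open Scope ereal_scope.

(* Nothing has to be said about the sign of [rate]: the two bounds for the
   whole space in [LDP] force its infimum to be 0. *)
Definition rate_function (rate : X -> \bar R) : Prop :=
  lower_semicontinuous rate /\
  forall L : R, (0 < L)%R -> compact [set x | rate x <= L%:E]%classic.

Definition LDP (nu : forall n : nat, probability (borel X) R)
    (speed : nat -> R) (rate : X -> \bar R) : Prop :=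
  rate_function rate /\
  forall B : set (borel X), measurable B ->
    [/\ - ereal_inf (rate @` interior (B : set X))%classic <=
          limn_einf (fun n => lne (nu n B) * ((speed n)^-1)%:E),
        limn_einf (fun n => lne (nu n B) * ((speed n)^-1)%:E) <=
          limn_esup (fun n => lne (nu n B) * ((speed n)^-1)%:E)
      & limn_esup (fun n => lne (nu n B) * ((speed n)^-1)%:E) <=
          - ereal_inf (rate @` closure (B : set X))%classic].

Definition LDP_under (d : nat -> measure_display)
    (T : forall n, measurableType (d n)) (mu : forall n, probability (T n) R)
    (Y : forall n, {mfun T n >-> borel X})
    (speed : nat -> R) (rate : X -> \bar R) : Prop :=
  LDP (fun n => distribution (mu n) (Y n)) speed rate.

End large_deviations.

Section linear_algebra.
Context {R : realType}.

Definition dot n (x y : 'cV[R]_n) : R := \sum_(i < n) x i 0 * y i 0.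

Definition posdefmx n (A : 'M[R]_n) : Prop :=
  forall x : 'cV[R]_n, x != 0 -> 0 < dot x (A *m x).

End linear_algebra.

(* [true] stands for the spin +1 and [false] for the spin -1. *)
Definition config (N : nat) : Type := {ffun 'I_N -> bool}.
HB.instance Definition _ N := Finite.on (config N).
HB.instance Definition _ N := isPointed.Build (config N) [ffun=> false].

Lemma config_measurable_display : measure_display.
Proof. exact: default_measure_display. Qed.

HB.instance Definition _ N :=
  @isMeasurable.Build config_measurable_display (config N)
    (@discrete_measurable (config N)) (@discrete_measurable0 (config N))
    (@discrete_measurableC (config N)) (@discrete_measurableU (config N)).

Section gibbs.
Context {R : realType} {N : nat}.

Definition spin (x : config N) : 'cV[R]_N := \col_j (if x j then 1 else -1).

Definition gibbs_weight (J : 'M[R]_N) (x : config N) : R :=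
  expR (2^-1 * dot (spin x) (J *m spin x)).

Definition partition_function (J : 'M[R]_N) : R :=
  \sum_(x : config N) gibbs_weight J x.

Variable J : 'M[R]_N.
Local Open Scope classical_set_scope.
Local Open Scope ereal_scope.

Definition gibbs (A : set (config N)) : \bar R :=
  \sum_(x : config N) (gibbs_weight J x / partition_function J)%:E * \d_x A.

Let partition_function_gt0 : (0 < partition_function J)%R.
Proof.
rewrite /partition_function (bigD1 ([ffun=> false] : config N)) //= ltr_pwDl ?expR_gt0//.
by apply: sumr_ge0 => x _; exact: expR_ge0.
Qed.

Let weight_ge0 x : 0 <= (gibbs_weight J x / partition_function J)%:E.
Proof. by rewrite lee_fin divr_ge0 ?expR_ge0// ltW. Qed.

Let gibbs0 : gibbs set0 = 0.
Proof. by rewrite /gibbs big1// => x _; rewrite measure0 mule0. Qed.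

Let gibbs_ge0 A : 0 <= gibbs A.
Proof. by apply: sume_ge0 => x _; rewrite mule_ge0. Qed.

Let gibbs_sigma_additive : semi_sigma_additive gibbs.
Proof.
move=> F mF tF mUF; rewrite [X in _ --> X](_ : _ =
    lim ((fun n => \sum_(0 <= i < n) gibbs (F i)) @ \oo)).
  by apply: is_cvg_ereal_nneg_natsum => k _; exact: gibbs_ge0.
rewrite nneseries_sum//; last by move=> x i _; rewrite mule_ge0.
apply: eq_bigr => x _.
by rewrite nneseriesZl// measure_semi_bigcup.
Qed.

HB.instance Definition _ := isMeasure.Build _ _ _ gibbs
  gibbs0 gibbs_ge0 gibbs_sigma_additive.

Let gibbsT : gibbs setT = 1.
Proof.
rewrite /gibbs; under eq_bigr do rewrite diracT mule1.
by rewrite sumEFin -mulr_suml divff// gt_eqF.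
Qed.

HB.instance Definition _ := Measure_isProbability.Build _ _ _ gibbs gibbsT.

End gibbs.

Section blocks.
Context {R : realType} {k N : nat}.

(* Injectivity says that the partition has [k] members, i.e. that the indexed
   family is repetition-free; [partition] makes every block nonempty. *)
Definition block_partition (B : 'I_k -> {set 'I_N}) : Prop :=
  [/\ finset.partition [set B i | i : 'I_k]%SET [set: 'I_N]%SET,
      injective B
    & forall (i j : 'I_k) (i0 j0 : 'I_N),
        i0 \in B i -> j0 \in B j -> (i < j)%N -> (i0 < j0)%N].

(* For a [block_partition] this determines [h]. *)
Definition block_index (B : 'I_k -> {set 'I_N}) (h : 'I_N -> 'I_k) : Prop :=
  forall a, a \in B (h a).

Definition block_coupling (A : 'M[R]_k) (h : 'I_N -> 'I_k) : 'M[R]_N :=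
  \matrix_(a, b) (N%:R^-1 * A (h a) (h b)).

Definition magnetization (B : 'I_k -> {set 'I_N}) (x : config N) :
    borel 'cV[R]_k :=
  \col_i (#|B i|%:R^-1 * \sum_(j in B i) spin x j 0).

Let measurable_magnetization B : measurable_fun setT (magnetization B).
Proof. by []. Qed.

HB.instance Definition _ B :=
  isMeasurableFun.Build _ _ _ _ (magnetization B) (measurable_magnetization B).

End blocks.

Section rate.
Context {R : realType}.

Definition cosh (t : R) : R := (expR t + expR (- t)) / 2.

Local Open Scope ereal_scope.

Definition convex_conjugate (f : R -> R) (x : R) : \bar R :=
  ereal_sup (range (fun t : R => (x * t - f t)%:E)).

Definition Lstar : R -> \bar R := convex_conjugate (fun t => ln (cosh t)).

Context {k : nat}.
Variables (A : 'M[R]_k) (gamma : 'I_k -> R).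

Let Gamma : 'M[R]_k := diag_mx (\row_i gamma i).

Definition Ifun (x : 'cV[R]_k) : \bar R :=
  (2^-1 * dot x (Gamma ^+ 2 *m A *m Gamma ^+ 2 *m x))%:E
  - \sum_(i < k) (gamma i ^+ 2)%:E * Lstar (x i ord0).

Definition Jfun (x : 'cV[R]_k) : \bar R := ereal_sup (range Ifun) - Ifun x.

End rate.

(* Main.v *)
Require Import Defs.
From HB Require Import structures.
From mathcomp Require Import all_boot all_order all_algebra.
From mathcomp Require Import all_classical all_reals all_analysis.
From mathcomp Require Import ring lra.

Set Implicit Arguments.
Unset Strict Implicit.
Unset Printing Implicit Defensive.

Import Order.TTheory GRing.Theory Num.Theory.
Import numFieldNormedType.Exports.
Local Open Scope classical_set_scope.
Local Open Scope ring_scope.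

(**
The proof is the method of types. The Gibbs weight of a configuration depends
only on its type, the number of up spins in each block: both the energy and the
block magnetizations are functions of these k counts. A type with n_i up spins
in a block of size b_i is realized by prod_i C(b_i, n_i) configurations, and

  C(b, n) = exp (b (ln 2 - L^*(m))) up to a factor in [1 / (b + 1), 1],

where m is the mean of b spins of which n are up. Hence the total weight of
one type with magnetizations y is exp (N (ln 2 + I_n y)) up to a factor
polynomial in N, where I_n is the function I of the statement with gamma_i^2
replaced by |B_i| / N ([weight_type_class_le], [weight_type_class_ge]).

There are at most (N + 1)^k types, and a polynomial factor is negligible at
speed N, so the weight of a set S of magnetizations is governed by the largest
value of I_n on the types in S. As |B_i| / N tends to gamma_i^2, I_n converges
to I uniformly on the cube [-1, 1]^k ([free_energy_uniform_cvg]). This bounds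
the weight of S from above by the supremum of I over the points of S in the
cube ([mass_upper]). From below, a point y of the cube in the interior of S is
a limit of types, which eventually lie in S, and I is
continuous on the whole cube, its boundary included, because t ln t is
continuous at 0 ([mass_lower]). The normalizing constant is the weight of the
whole space, so dividing by it subtracts sup I ([probability_upper],
[probability_lower]).

Two facts relate I to the extended-valued function of the statement. The
conjugate L^* equals the entropy of a coin of mean x on [-1, 1] by Gibbs'
inequality, and is +oo elsewhere because ln cosh t is at most |t|
([Lstar_coin_entropy], [Lstar_pinfty]). So the rate function is sup I - I on
the cube, where I is continuous, and +oo off it; as the cube is compact, the
rate function is lower semicontinuous with compact sublevel sets
([Jfun_rate_function]).
*)

(** * The entropy of a coin and the conjugate of ln cosh *)

Section entropy.
Context {R : realType}.
Implicit Types t v x y p : R.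

Lemma ln_le_subr1 v : 0 < v -> ln v <= v - 1.
Proof.
move=> v0; rewrite -[v in ln v](subrK 1) [_ - _ + _]addrC le_ln1Dx//.
by rewrite ltrBrDr addrC subrr.
Qed.

Definition xlnx t : R := t * ln t.

Lemma xlnx0 : xlnx 0 = 0. Proof. by rewrite /xlnx mul0r. Qed.

Lemma xlnx_le0 t : t <= 1 -> xlnx t <= 0.
Proof.
move=> t1; rewrite /xlnx; have [t0|t0] := ltP 0 t.
  by rewrite mulr_ge0_le0 ?ln_le0// ltW.
by rewrite ln0// mulr0.
Qed.

(** Writing t = s^2 turns t ln t into 2 s (s ln s), and
|s ln s| = s ln (1 / s) is at most 1; the bound gives the continuity of t ln t
at 0. *)
Lemma norm_xlnx_le t : `|t| <= 1 -> `|xlnx t| <= 2 * Num.sqrt `|t|.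
Proof.
move=> t1; have [t0|t0] := ltP 0 t; last first.
  by rewrite /xlnx ln0// mulr0 normr0 mulr_ge0.
rewrite (gtr0_norm t0) in t1 *; rewrite ler0_norm ?xlnx_le0//.
set s := Num.sqrt t; have s0 : 0 < s by rewrite sqrtr_gt0.
have ts : t = s * s by rewrite -expr2 sqr_sqrtr// ltW.
have -> : - xlnx t = 2 * s * (s * ln s^-1).
  by rewrite /xlnx ts lnM// lnV//; ring.
rewrite ger_pMr ?mulr_gt0//.
have sV0 : 0 < s^-1 by rewrite invr_gt0.
have /ltW := ln_sublinear sV0.
by rewrite -(ler_pM2l s0) mulfV// gt_eqF.
Qed.

(** Continuity holds on the whole line since [ln] is 0 on the nonpositive reals.
Thanks to this the entropy below is continuous up to the boundary of [-1, 1]. *)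
Lemma continuous_xlnx : continuous xlnx.
Proof.
move=> t; have [t0|t0|->] := ltgtP t 0.
- have ht : \near t, 0 = xlnx t.
    near=> s; rewrite /xlnx ln0 ?mulr0//; apply/ltW.
    by near: s; exact: lt_nbhsl.
  rewrite /continuous_at -(nbhs_singleton ht).
  by apply: cvg_trans (near_eq_cvg ht) _; exact: cvg_cst.
- by apply: cvgM; [exact: cvg_id|exact: continuous_ln].
- apply/cvgrPdist_le => e e0; near=> s.
  rewrite xlnx0 sub0r normrN.
  have s1 : `|s| <= 1 by near: s; exact: (@nbhs0_le _ R^o).
  have se : `|s| <= (e / 2) ^+ 2.
    by near: s; apply: (@nbhs0_le _ R^o); rewrite exprn_gt0// divr_gt0.
  apply: (le_trans (norm_xlnx_le s1)).
  rewrite -(@ler_pM2l _ 2^-1)// mulKf// mulrC.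
  apply: (le_trans (_ : _ <= Num.sqrt ((e / 2) ^+ 2))).
    by rewrite ler_sqrt// exprn_ge0// ltW// divr_gt0.
  by rewrite sqrtr_sqr gtr0_norm// divr_gt0.
Unshelve. all: by end_near. Qed.

(** The relative entropy, with respect to a fair coin, of a spin of mean x: such a
spin is up with probability (1 + x) / 2 and down with probability (1 - x) / 2. *)
Definition coin_entropy x : R := 2^-1 * xlnx (1 + x) + 2^-1 * xlnx (1 - x).

Lemma coin_entropyE x : coin_entropy x =
  2^-1 * (1 + x) * ln (1 + x) + 2^-1 * (1 - x) * ln (1 - x).
Proof. by rewrite /coin_entropy /xlnx !mulrA. Qed.

Lemma continuous_coin_entropy : continuous coin_entropy.
Proof.
move=> x; apply: cvgD; apply: cvgMr.
  apply: (continuous_comp (f := fun y => 1 + y) (g := xlnx)).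
    by apply: cvgD; [exact: cvg_cst|exact: cvg_id].
  exact: continuous_xlnx.
apply: (continuous_comp (f := fun y => 1 - y) (g := xlnx)).
  by apply: cvgB; [exact: cvg_cst|exact: cvg_id].
exact: continuous_xlnx.
Qed.

Lemma cosh_gt0 t : 0 < cosh t.
Proof. by rewrite /cosh divr_gt0// addr_gt0// expR_gt0. Qed.

(** Gibbs' inequality p ln (v / p) <= v - p, in a form that includes p = 0. *)
Lemma gibbs_inequality p v : 0 <= p -> 0 < v -> p * ln v - xlnx p <= v - p.
Proof.
rewrite le_eqVlt => /predU1P[<-|p0] v0.
  by rewrite xlnx0 mul0r !subr0 ltW.
rewrite /xlnx -mulrBr -ln_div//.
apply: (le_trans (ler_wpM2l (ltW p0) (ln_le_subr1 _))); first exact: divr_gt0.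
by rewrite mulrBr mulr1 mulrCA divff ?gt_eqF// mulr1.
Qed.

(** Gibbs' inequality for the weights 1 + x and 1 - x against the tilted weights
exp (t) / cosh t and exp (- t) / cosh t, which also sum to 2. *)
Lemma conjugate_le_coin_entropy x t : -1 <= x <= 1 ->
  x * t - ln (cosh t) <= coin_entropy x.
Proof.
move=> /andP[x1 x2]; have c0 := cosh_gt0 t.
have ha : 0 <= 1 + x by lra.
have hb : 0 <= 1 - x by lra.
have e1 : 0 < expR t / cosh t by rewrite divr_gt0// expR_gt0.
have e2 : 0 < expR (- t) / cosh t by rewrite divr_gt0// expR_gt0.
have cE : expR t + expR (- t) = 2 * cosh t by rewrite /cosh mulrC divfK.
have := lerD (gibbs_inequality ha e1) (gibbs_inequality hb e2).
rewrite /coin_entropy; move: (cosh t) c0 cE e1 e2 => c c0 cE e1 e2.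
rewrite !ln_div ?posrE ?expR_gt0// !expRK.
have -> : expR t / c - (1 + x) + (expR (- t) / c - (1 - x)) = 0.
  by rewrite addrACA -mulrDl cE mulfK ?gt_eqF//; ring.
lra.
Qed.

Lemma coshN t : cosh (- t) = cosh t.
Proof. by rewrite /cosh opprK addrC. Qed.

Lemma coin_entropyN x : coin_entropy (- x) = coin_entropy x.
Proof. by rewrite /coin_entropy opprK addrC. Qed.

(** For |x| < 1 the bound is attained where the derivative x - tanh t vanishes.
At x = 1 and x = -1 the supremum is only approached, as t tends to infinity,
which is why an error e is allowed. *)
Lemma conjugate_near_coin_entropy x (e : R) : -1 <= x <= 1 -> 0 < e ->
  exists t, coin_entropy x - e <= x * t - ln (cosh t).
Proof.
have lncoshE t : ln (cosh t) = t + ln (1 + expR (- (t *+ 2))) - ln 2.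
  have -> : cosh t = expR t * ((1 + expR (- (t *+ 2))) / 2).
    rewrite /cosh mulrA mulrDr mulr1 -expRD; congr ((_ + expR _) / _); ring.
  rewrite lnM ?posrE ?expR_gt0 ?divr_gt0 ?addr_gt0 ?expR_gt0// expRK.
  by rewrite ln_div ?posrE ?addr_gt0 ?expR_gt0// addrA.
move=> + e0.
have at1 : exists t, coin_entropy 1 - e <= 1 * t - ln (cosh t).
  (* This t solves exp (- 2 t) = e. *)
  exists (- (2^-1 * ln e)); rewrite lncoshE.
  set t := _ * ln e.
  have -> : expR (- (- t *+ 2)) = e.
    by rewrite -[RHS]lnK ?posrE//; congr expR; rewrite /t; lra.
  rewrite /coin_entropy /xlnx subrr mul0r.
  have := @ln_le_subr1 (1 + e).
  rewrite (_ : 1 + 1 = 2 :> R)//; lra.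
move=> /andP[]; rewrite le_eqVlt => /predU1P[<- _|x1].
  have [t ht] := at1; exists (- t).
  by rewrite coin_entropyN coshN mulrNN.
rewrite le_eqVlt => /predU1P[-> //|x2].
have a0 : 0 < 1 + x by lra.
have b0 : 0 < 1 - x by lra.
(* This t is the inverse hyperbolic tangent of x. *)
set t : R := 2^-1 * ln ((1 + x) / (1 - x)); exists t.
suff : x * t - ln (cosh t) = coin_entropy x.
  by move=> ->; rewrite lerBlDr lerDl ltW.
have t2 : t *+ 2 = ln (1 + x) - ln (1 - x) by rewrite -mulr_natl /t mulVKf// ln_div.
have t2N : - (t *+ 2) = ln (1 - x) - ln (1 + x) by rewrite t2 opprB.
rewrite lncoshE t2N expRD expRN !lnK//.
have -> : 1 + (1 - x) / (1 + x) = 2 / (1 + x).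
  by field; rewrite gt_eqF.
rewrite ln_div ?posrE// /coin_entropy /xlnx; move: t2.
set a := ln _; set b := ln _; move: (ln 2) => c t2.
have -> : t = 2^-1 * (a - b) by lra.
by field.
Qed.

Lemma cosh_le_expR t : cosh t <= expR `|t|.
Proof.
have h1 : expR t <= expR `|t| by rewrite ler_expR ler_norm.
have h2 : expR (- t) <= expR `|t| by rewrite ler_expR -normrN ler_norm.
by rewrite /cosh ler_pdivrMr//; lra.
Qed.

Lemma Lstar_coin_entropy x : -1 <= x <= 1 -> Lstar x = (coin_entropy x)%:E.
Proof.
move=> x1; apply/eqP; rewrite eq_le; apply/andP; split.
  by apply: ge_ereal_sup => _ [t _ <-]; rewrite lee_fin conjugate_le_coin_entropy.
apply/lee_addgt0Pr => e e0.
have [t ht] := conjugate_near_coin_entropy x1 e0.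
rewrite -leeBlDr// -EFinB.
apply: (@le_trans _ _ (x * t - ln (cosh t))%:E); first by rewrite lee_fin.
by apply: ereal_sup_ubound; exists t.
Qed.

(** For |x| > 1 the choice t = sg(x) s gives x t - ln (cosh t) >= (|x| - 1) s,
unbounded in s. *)
Lemma Lstar_pinfty x : ~~ (-1 <= x <= 1) -> Lstar x = +oo%E.
Proof.
rewrite -ler_norml -ltNge => x1; apply: eq_infty => r.
have s0 : 0 < `|x| - 1 by rewrite subr_gt0.
set t : R := Num.sg x * (`|r| / (`|x| - 1)).
apply: (@le_trans _ _ (x * t - ln (cosh t))%:E); last first.
  by apply: ereal_sup_ubound; exists t.
have xn0 : x != 0 by rewrite -normr_gt0 (lt_trans _ x1).
have tE : `|t| = `|r| / (`|x| - 1).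
  by rewrite normrM normr_sg xn0 mul1r ger0_norm// divr_ge0// ltW.
have xt : x * t = `|x| * `|t| by rewrite tE mulrA [x * _]mulrC -normrEsg.
rewrite lee_fin xt; apply: (@le_trans _ _ ((`|x| - 1) * `|t|)).
  by rewrite tE mulrC divfK ?gt_eqF// ler_norm.
rewrite mulrBl mul1r lerD2l lerN2 -[leRHS]expRK ler_ln ?posrE ?expR_gt0 ?cosh_gt0//.
exact: cosh_le_expR.
Qed.

Lemma coin_entropy_ge0 x : -1 <= x <= 1 -> 0 <= coin_entropy x.
Proof.
move=> /(conjugate_le_coin_entropy 0); apply: le_trans.
by rewrite mulr0 /cosh oppr0 expR0 divff// ln1 subrr.
Qed.

Lemma coin_entropy_le x : -1 <= x <= 1 -> coin_entropy x <= ln 2.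
Proof.
move=> /andP[x1 x2].
have h p : 0 <= p <= 2 -> xlnx p <= p * ln 2.
  move=> /andP[]; rewrite le_eqVlt => /predU1P[<- _|p0 p2].
    by rewrite xlnx0 mul0r.
  by rewrite /xlnx ler_pM2l// ler_ln ?posrE.
have := h (1 + x); have := h (1 - x); rewrite /coin_entropy.
set u := xlnx _; set v := xlnx _; move: (ln 2) => l.
by lra.
Qed.
End entropy.

(** * Entropy bounds for binomial coefficients *)

Section binomials.
Local Open Scope nat_scope.

(** In other words j^i / i! is largest at i = j: passing from i to i + 1 multiplies
it by j / (i + 1). *)
Lemma fact_mul_expn_le i j : j`! * j ^ i <= i`! * j ^ j.
Proof.
have [/subnKC|/ltnW/subnKC] := leqP i j.
  move=> ij; suff up m d : i + d <= m -> (i + d)`! <= i`! * m ^ d.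
    by rewrite -{4}ij expnD mulnCA mulnC leq_mul2l -[j in j`!]ij up ?orbT// ij.
  elim: d => [|d IHd]; first by rewrite addn0 expn0 muln1.
  rewrite addnS => idm; rewrite factS expnS mulnCA leq_mul//.
  exact/IHd/ltnW.
move=> <-; rewrite expnD mulnCA mulnC leq_mul2r; apply/orP; right.
elim: (i - j) => [|d IHd]; first by rewrite addn0 expn0 muln1.
by rewrite addnS factS expnS mulnCA leq_mul// ltnW// ltnS leq_addr.
Qed.

(** The mode of the binomial law with n trials and mean j is j. The common
denominator n^n is cleared, so that the comparison takes place in nat and includes
the degenerate cases j = 0 and j = n through 0 ^ 0 = 1. *)
Lemma binomial_term_le n i j : i <= n -> j <= n ->
  'C(n, i) * (j ^ i * (n - j) ^ (n - i)) <= 'C(n, j) * (j ^ j * (n - j) ^ (n - j)).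
Proof.
move=> ni nj.
have := leq_mul (fact_mul_expn_le i j) (fact_mul_expn_le (n - i) (n - j)).
rewrite -(leq_pmul2l (fact_gt0 n)) => h.
rewrite -(leq_pmul2r (fact_gt0 i)) -(leq_pmul2r (fact_gt0 (n - i))).
rewrite -(leq_pmul2r (fact_gt0 j)) -(leq_pmul2r (fact_gt0 (n - j))).
have /esym ei := bin_fact ni; have /esym ej := bin_fact nj.
set lhs := (X in is_true (X <= _)); set rhs := (X in is_true (_ <= X)).
have -> : lhs = n`! * (j`! * j ^ i * ((n - j)`! * (n - j) ^ (n - i))).
  by rewrite ei /lhs; ring.
have -> : rhs = n`! * (i`! * j ^ j * ((n - i)`! * (n - j) ^ (n - j))).
  by rewrite ej /rhs; ring.
exact: h.
Qed.

Lemma expn_binomial_sum n j : j <= n ->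
  n ^ n = \sum_(i < n.+1) 'C(n, i) * (j ^ i * (n - j) ^ (n - i)).
Proof.
move=> nj; rewrite -[n in n ^ _](subnK nj) expnDn.
by apply: eq_bigr => i _; congr (_ * _); exact: mulnC.
Qed.

Lemma binomial_expn_le n j : j <= n ->
  'C(n, j) * (j ^ j * (n - j) ^ (n - j)) <= n ^ n.
Proof.
move=> nj; rewrite [leqRHS](expn_binomial_sum nj).
have jn : j < n.+1 by [].
by rewrite (bigD1 (Ordinal jn)) //= leq_addr.
Qed.

(** The n + 1 terms of the binomial expansion of (j + (n - j))^n are at most the
modal one. *)
Lemma expn_le_binomial n j : j <= n ->
  n ^ n <= n.+1 * ('C(n, j) * (j ^ j * (n - j) ^ (n - j))).
Proof.
move=> nj; rewrite [leqLHS](expn_binomial_sum nj).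
rewrite -[n.+1 in leqRHS]card_ord -sum_nat_const; apply: leq_sum => i _.
by apply: binomial_term_le => //; rewrite -ltnS.
Qed.
End binomials.

Section log_binomials.
Context {R : realType}.

Lemma ln_expn_self (m : nat) : ln ((m ^ m)%N%:R : R) = xlnx m%:R.
Proof.
case: m => [|m]; first by rewrite expn0 ln1 xlnx0.
by rewrite natrX lnXn// /xlnx mulr_natl.
Qed.

(** The mean of n spins, j of which are +1. *)
Definition updown (n j : nat) : R := n%:R^-1 * (j%:R - (n - j)%:R).

Lemma updown_itv n j : (j <= n)%N -> -1 <= updown n j <= 1.
Proof.
case: n => [|n] jn.
  by move: jn; rewrite leqn0 => /eqP->; rewrite /updown invr0 mul0r; lra.
rewrite /updown natrB//; set b := n.+1%:R : R.
have b0 : 0 < b by rewrite ltr0n.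
have jb : j%:R <= b by rewrite ler_nat.
have j0 : 0 <= j%:R :> R by rewrite ler0n.
rewrite mulrC ler_pdivlMr// ler_pdivrMr//; apply/andP; split; lra.
Qed.

Lemma coin_entropy_updown n j : (0 < n)%N -> (j <= n)%N ->
  n%:R * coin_entropy (updown n j) =
  n%:R * ln 2 + xlnx j%:R + xlnx (n - j)%:R - xlnx n%:R.
Proof.
move=> n0 jn; have b0 : 0 < n%:R :> R by rewrite ltr0n.
have half m : n%:R * (2^-1 * xlnx (2 * m%:R / n%:R)) =
    m%:R * (ln 2 - ln n%:R) + xlnx m%:R :> R.
  case: m => [|m]; first by rewrite mulr0 mul0r xlnx0 !mul0r !mulr0 addr0.
  have m0 : 0 < m.+1%:R :> R by rewrite ltr0n.
  rewrite /xlnx ln_div ?posrE ?mulr_gt0// lnM ?posrE//.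
  by field; rewrite gt_eqF.
have e1 : 1 + updown n j = 2 * j%:R / n%:R.
  by rewrite /updown natrB//; field; rewrite gt_eqF.
have e2 : 1 - updown n j = 2 * (n - j)%:R / n%:R.
  by rewrite /updown natrB//; field; rewrite gt_eqF.
rewrite /coin_entropy e1 e2 mulrDr !half natrB// [xlnx n%:R]/xlnx.
by ring.
Qed.

Lemma ln_binomial_decomp n j : (j <= n)%N ->
  ln ('C(n, j) * (j ^ j * (n - j) ^ (n - j)))%N%:R =
  ln 'C(n, j)%:R + xlnx j%:R + xlnx (n - j)%:R :> R.
Proof.
move=> jn.
have pp m : (0 < m ^ m)%N by case: m => // m; rewrite expn_gt0.
rewrite natrM lnM ?posrE ?ltr0n ?muln_gt0 ?pp ?bin_gt0//.
by rewrite natrM lnM ?posrE ?ltr0n ?pp// !ln_expn_self addrA.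
Qed.

Lemma binomial_le_exp_entropy n j : (0 < n)%N -> (j <= n)%N ->
  'C(n, j)%:R <= expR (n%:R * (ln 2 - coin_entropy (updown n j))) :> R.
Proof.
move=> n0 jn.
have C0 : 0 < 'C(n, j)%:R :> R by rewrite ltr0n bin_gt0.
rewrite -[leLHS]lnK ?posrE// ler_expR mulrBr coin_entropy_updown//.
have pp m : (0 < m ^ m)%N by case: m => // m; rewrite expn_gt0.
have : ln ('C(n, j) * (j ^ j * (n - j) ^ (n - j)))%N%:R <= ln (n ^ n)%N%:R :> R.
  rewrite ler_ln ?posrE ?ltr0n ?muln_gt0 ?bin_gt0 ?jn ?pp//.
  by rewrite ler_nat binomial_expn_le.
rewrite ln_binomial_decomp// ln_expn_self; lra.
Qed.

Lemma exp_entropy_le_binomial n j : (0 < n)%N -> (j <= n)%N ->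
  expR (n%:R * (ln 2 - coin_entropy (updown n j))) <= n.+1%:R * 'C(n, j)%:R :> R.
Proof.
move=> n0 jn.
have C0 : 0 < 'C(n, j)%:R :> R by rewrite ltr0n bin_gt0.
have n1 : 0 < n.+1%:R :> R by rewrite ltr0n.
rewrite -[leRHS]lnK ?posrE ?mulr_gt0// ler_expR mulrBr coin_entropy_updown//.
have pp m : (0 < m ^ m)%N by case: m => // m; rewrite expn_gt0.
have : ln (n ^ n)%N%:R <=
    ln (n.+1 * ('C(n, j) * (j ^ j * (n - j) ^ (n - j))))%N%:R :> R.
  rewrite ler_ln ?posrE ?ltr0n ?muln_gt0 ?bin_gt0 ?jn ?pp//.
  by rewrite ler_nat expn_le_binomial.
rewrite natrM lnM ?posrE ?ltr0n ?muln_gt0 ?bin_gt0 ?jn ?pp//.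
rewrite ln_binomial_decomp// ln_expn_self lnM ?posrE//; lra.
Qed.
End log_binomials.

(** * Weights of types *)

Definition cube {R : realType} {k : nat} : set 'cV[R]_k :=
  [set y | forall i, -1 <= y i 0 <= 1].

Section types.
Context {R : realType} {k N : nat} (A : 'M[R]_k).
Context (B : 'I_k -> {set 'I_N}) (h : 'I_N -> 'I_k).
Hypotheses (B_partition : block_partition B) (h_index : block_index B h).
Implicit Types (x : config N) (t : {ffun 'I_k -> 'I_N.+1}).

Lemma mem_block a i : (a \in B i) = (h a == i).
Proof.
have [/and3P[_ /finset.trivIsetP tI _] injB _] := B_partition.
apply/idP/eqP => [ai|<-]; last exact: h_index.
apply/eqP; apply: contraT => hai.
have /tI : B (h a) \in [set B i | i : 'I_k]%SET by exact: imset_f.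
move=> /(_ (B i)) /(_ (imset_f _ isT)).
rewrite (inj_eq injB) => /(_ hai) /disjointFr /(_ (h_index a)).
by rewrite ai.
Qed.

Lemma block_gt0 i : (0 < #|B i|)%N.
Proof.
have [/and3P[_ _ B0] _ _] := B_partition.
rewrite card_gt0; apply: contra B0 => /eqP <-; exact: imset_f.
Qed.

Lemma block_le i : (#|B i| <= N)%N.
Proof. by rewrite -[leqRHS]card_ord max_card. Qed.

Lemma sum_over_blocks (F : 'I_N -> R) :
  \sum_a F a = \sum_i \sum_(a in B i) F a.
Proof.
rewrite (partition_big h predT)//=; apply: eq_bigr => i _.
by apply: eq_bigl => a; rewrite mem_block.
Qed.

Lemma sum_card_blocks : \sum_i #|B i|%:R = N%:R :> R.
Proof.
rewrite -[N in RHS]card_ord -sumr_const sum_over_blocks.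
by apply: eq_bigr => i _; rewrite sumr_const.
Qed.

Definition upcount x i : nat := #|[set a in B i | x a]%SET|.

Lemma upcount_le x i : (upcount x i <= #|B i|)%N.
Proof. by apply: subset_leq_card; apply/fintype.subsetP => a; rewrite inE => /andP[]. Qed.

Lemma sum_spin x i : \sum_(a in B i) (spin x a 0 : R) = #|B i|%:R * updown #|B i| (upcount x i).
Proof.
rewrite /updown mulVKf ?pnatr_eq0 -?lt0n ?block_gt0//.
have -> : (#|B i| - upcount x i)%N = #|[set a in B i | ~~ x a]%SET|.
  rewrite -[#|B i|](cardsID [set a | x a]%SET) [X in (X + _ - _)%N](_ : _ = upcount x i).
    by rewrite addKn; apply: eq_card => a; rewrite !inE andbC.
  by apply: eq_card => a; rewrite !inE.
rewrite (bigID (fun a => x a))/=; congr (_ + _).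
  rewrite -sumr_const; apply: eq_big => [a|a /andP[_ xa]]; first by rewrite inE.
  by rewrite mxE xa.
rewrite -sumr_const -sumrN; apply: eq_big => [a|a /andP[_ /negbTE xa]]; first by rewrite inE.
by rewrite mxE xa.
Qed.

Definition profile (n : 'I_k -> nat) : 'cV[R]_k := \col_i updown #|B i| (n i).

Lemma magnetizationE x : magnetization B x = profile (upcount x).
Proof.
apply/colP => i; rewrite !mxE sum_spin mulKf//.
by rewrite pnatr_eq0 -lt0n block_gt0.
Qed.

(** The function I of the theorem is the case where rho i is gamma i squared; at
finite volume rho i is the fraction of sites that lie in block i. *)
Definition free_energy (rho : 'I_k -> R) (y : 'cV[R]_k) : R :=
  2^-1 * (\sum_i \sum_j A i j * (rho i * y i 0) * (rho j * y j 0)) -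
  \sum_i rho i * coin_entropy (y i 0).

Definition frequency i : R := #|B i|%:R / N%:R.

Hypothesis N_gt0 : (0 < N)%N.

(** The coupling is constant on pairs of blocks, so the energy is a quadratic form in
the block magnetizations. *)
Lemma gibbs_weightE x : gibbs_weight (block_coupling A h) x =
  expR (N%:R * (2^-1 * \sum_i \sum_j A i j *
    (frequency i * magnetization B x i 0) * (frequency j * magnetization B x j 0))).
Proof.
congr expR; rewrite mulrCA; congr (_ * _).
rewrite /dot sum_over_blocks mulr_sumr; apply: eq_bigr => i _.
pose S j : R := \sum_(b in B j) spin x b 0.
transitivity (\sum_(a in B i) spin x a 0 * (N%:R^-1 * \sum_j A i j * S j)).
  apply: eq_bigr => a; rewrite mem_block => /eqP <-; congr (_ * _).
  rewrite mxE sum_over_blocks mulr_sumr; apply: eq_bigr => j _.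
  rewrite mulr_sumr mulr_sumr; apply: eq_bigr => b.
  by rewrite mem_block mxE => /eqP <-; rewrite mulrA.
have SE j : S j = N%:R * (frequency j * magnetization B x j 0).
  rewrite magnetizationE mxE /S sum_spin /frequency; field.
  by rewrite pnatr_eq0 -lt0n.
rewrite -mulr_suml -/(S i) !mulr_sumr; apply: eq_bigr => j _.
rewrite !SE; field.
by rewrite pnatr_eq0 -lt0n.
Qed.

Definition type_class (n : 'I_k -> nat) : {set config N} :=
  [set x | [forall i, upcount x i == n i]]%SET.

(** A configuration of the class amounts to an independent choice, in each block, of
the set of its up spins. *)
Lemma card_type_class n : #|type_class n| = (\prod_i 'C(#|B i|, n i))%N.
Proof.
pose draws i := [set S : {set 'I_N} | S \subset B i & #|S| == n i]%SET.
pose ups (x : config N) := [ffun i => [set a in B i | x a]%SET].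
have ups_inj : injective ups.
  move=> x y /ffunP xy; apply/ffunP => a.
  have := xy (h a); rewrite !ffunE => /setP/(_ a).
  by rewrite !inE h_index.
rewrite -(card_imset _ ups_inj).
have -> : (ups @: type_class n)%SET = [set f | f \in family draws]%SET.
  apply/setP => f; rewrite inE; apply/imsetP/familyP => [[x xn ->] i|fn].
    move: xn; rewrite inE => /forallP/(_ i); rewrite ffunE inE => ->.
    by rewrite andbT; apply/fintype.subsetP => a; rewrite inE => /andP[].
  have upsf : ups [ffun a => a \in f (h a)] = f.
    apply/ffunP => i; rewrite ffunE; apply/setP => a; rewrite inE ffunE mem_block.
    have [<-//|hai] := eqVneq (h a) i.
    have := fn i; rewrite inE => /andP[/fintype.subsetP/(_ a) + _].
    by rewrite mem_block (negbTE hai); case: (a \in f i) => // /(_ isT).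
  exists [ffun a => a \in f (h a)] => //; rewrite inE; apply/forallP => i.
  have := fn i; rewrite inE => /andP[_ /eqP <-].
  by rewrite -[in X in _ == X]upsf ffunE.
rewrite cardsE card_family foldrE big_map big_enum /=.
by apply: eq_bigr => i _; rewrite cards_draws.
Qed.

Lemma weight_type_class n : 
  \sum_(x in type_class n) gibbs_weight (block_coupling A h) x =
  (\prod_i 'C(#|B i|, n i))%:R * 
  expR (N%:R * (2^-1 * \sum_i \sum_j A i j *
    (frequency i * profile n i 0) * (frequency j * profile n j 0))).
Proof.
rewrite -card_type_class mulr_natl -sumr_const; apply: eq_bigr => x.
rewrite inE => /forallP xn; rewrite gibbs_weightE.
have -> // : magnetization B x = profile n.
by rewrite magnetizationE; apply/colP => i; rewrite !mxE (eqP (xn i)).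
Qed.

Definition mass (S : set 'cV[R]_k) : R :=
  \sum_(x | magnetization B x \in S) gibbs_weight (block_coupling A h) x.

(** The term ln 2 is spread over the blocks, whose sizes add up to N, so that each
block receives the exponential approximation of its binomial coefficient. *)
Lemma exp_free_energyE n : 
  expR (N%:R * (ln 2 + free_energy frequency (profile n))) =
  \prod_i expR (#|B i|%:R * (ln 2 - coin_entropy (updown #|B i| (n i)))) *
  expR (N%:R * (2^-1 * \sum_i \sum_j A i j *
    (frequency i * profile n i 0) * (frequency j * profile n j 0))).
Proof.
rewrite -expR_sum -expRD; congr expR.
rewrite /free_energy mulrDr mulrBr [in RHS]addrC addrCA; congr (_ + _).
under [in RHS]eq_bigr do rewrite mulrBr.
rewrite sumrB -mulr_suml sum_card_blocks; congr (_ - _).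
rewrite mulr_sumr; apply: eq_bigr => i _; rewrite mxE /frequency.
by field; rewrite pnatr_eq0 -lt0n.
Qed.

Lemma weight_type_class_le n : (forall i, n i <= #|B i|)%N ->
  \sum_(x in type_class n) gibbs_weight (block_coupling A h) x <=
  expR (N%:R * (ln 2 + free_energy frequency (profile n))).
Proof.
move=> nB; rewrite weight_type_class exp_free_energyE ler_wpM2r ?expR_ge0//.
rewrite natr_prod; apply: ler_prod => i _; rewrite ler0n/=.
by rewrite binomial_le_exp_entropy ?block_gt0.
Qed.

Lemma weight_type_class_ge n : (forall i, n i <= #|B i|)%N ->
  expR (N%:R * (ln 2 + free_energy frequency (profile n))) <=
  N.+1%:R ^+ k * \sum_(x in type_class n) gibbs_weight (block_coupling A h) x.
Proof.
move=> nB; rewrite weight_type_class exp_free_energyE [leRHS]mulrA.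
rewrite ler_wpM2r ?expR_ge0//.
rewrite natr_prod -[k in _ ^+ k]card_ord -prodr_const -big_split/=.
apply: ler_prod => i _; rewrite expR_ge0/=.
apply: (le_trans (exp_entropy_le_binomial _ _)); rewrite ?block_gt0//.
by rewrite ler_wpM2r// ler_nat ltnS block_le.
Qed.

Lemma profile_cube n : (forall i, n i <= #|B i|)%N ->
  cube (profile n).
Proof. by move=> nB i; rewrite mxE updown_itv. Qed.

(** Configurations are sorted by type; there are at most (N + 1)^k types, and those
that meet S contribute at most exp (N (ln 2 + r)) each. *)
Lemma mass_le (S : set 'cV[R]_k) r :
  (forall y, S y -> cube y -> free_energy frequency y <= r) ->
  mass S <= N.+1%:R ^+ k * expR (N%:R * (ln 2 + r)).
Proof.
move=> Sr; pose ty x : {ffun 'I_k -> 'I_N.+1} := [ffun i => inord (upcount x i)].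
have tyE x i : ty x i = upcount x i :> nat.
  by rewrite ffunE inordK// ltnS (leq_trans (upcount_le x i))// block_le.
rewrite /mass (partition_big ty predT)//=.
have -> : N.+1%:R ^+ k = #|{ffun 'I_k -> 'I_N.+1}|%:R :> R.
  by rewrite card_ffun !card_ord natrX.
rewrite mulr_natl -sumr_const; apply: ler_sum => t _.
have [x0 /andP[x0S /eqP x0t]|none] := pickP
    (fun x => (magnetization B x \in S) && (ty x == t)); last first.
  by rewrite big_pred0// expR_ge0.
pose n i : nat := t i.
have nB i : (n i <= #|B i|)%N by rewrite /n -x0t tyE upcount_le.
have mE x : ty x = t -> magnetization B x = profile n.
  by move=> xt; rewrite magnetizationE; apply/colP => i; rewrite !mxE /n -xt tyE.
apply: (@le_trans _ _ (\sum_(x in type_class n) gibbs_weight (block_coupling A h) x)).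
  rewrite [leRHS](bigID (fun x => (magnetization B x \in S) && (ty x == t)))/=.
  rewrite -[leLHS]addr0 lerD//; last by apply: sumr_ge0 => x _; exact: expR_ge0.
  rewrite le_eqVlt; apply/orP; left; apply/eqP/eq_bigl => x.
  rewrite inE; case: eqP => [xt|]; rewrite ?andbF ?andbT//.
  rewrite (_ : [forall i, _])//; by apply/forallP => i; rewrite /n -xt tyE.
apply: (le_trans (weight_type_class_le nB)).
rewrite ler_expR ler_pM2l ?ltr0n// lerD2l; apply: Sr; last exact: profile_cube.
by move: x0S; rewrite inE (mE _ x0t).
Qed.

(** A single type already gives the lower bound. *)
Lemma mass_ge (S : set 'cV[R]_k) n : (forall i, n i <= #|B i|)%N ->
  S (profile n) ->
  expR (N%:R * (ln 2 + free_energy frequency (profile n))) <=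
  N.+1%:R ^+ k * mass S.
Proof.
move=> nB Sn; apply: (le_trans (weight_type_class_ge nB)).
rewrite ler_wpM2l ?exprn_ge0 ?ler0n//.
rewrite /mass [leRHS](bigID (fun x => x \in type_class n))/=.
rewrite -[leLHS]addr0 lerD//; last by apply: sumr_ge0 => x _; exact: expR_ge0.
rewrite le_eqVlt; apply/orP; left; apply/eqP/eq_bigl => x.
rewrite inE; case: forallP => [xn|]; rewrite ?andbF ?andbT//.
apply/esym/mem_set.
suff -> : magnetization B x = profile n by [].
by rewrite magnetizationE; apply/colP => i; rewrite !mxE (eqP (xn i)).
Qed.

End types.

(** * Continuity of the free energy in its coefficients and its argument *)

Lemma cvg_fsum {R : realType} {T : Type} {I : finType} (F : set_system T)
    {FF : Filter F} (f : I -> T -> R) (l : I -> R) :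
  (forall i, f i x @[x --> F] --> l i) ->
  (\sum_i f i x) @[x --> F] --> \sum_i l i.
Proof. by move=> fl; apply: cvg_big => // -[a b]; exact: add_continuous. Qed.

Section free_energy_topology.
Context {R : realType} {k : nat} (A : 'M[R]_k).
Implicit Types (rho g : 'I_k -> R) (y : 'cV[R]_k).

Lemma cvg_free_energy {T : Type} (F : set_system T) {FF : Filter F} rho
    (u : T -> 'cV[R]_k) y :
  (forall i, u x i 0 @[x --> F] --> y i 0) ->
  free_energy A rho (u x) @[x --> F] --> free_energy A rho y.
Proof.
move=> uy; apply: cvgB.
  apply: cvgMr; apply: cvg_fsum => i; apply: cvg_fsum => j.
  by apply: cvgM; [apply: cvgMr|]; exact: cvgMr.
apply: cvg_fsum => i; apply: cvgMr.
exact: (@continuous_cvg _ _ _ F FF (fun x => u x i 0) _ _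
  (@continuous_coin_entropy R (y i 0)) (uy i)).
Qed.

Lemma continuous_free_energy rho : continuous (free_energy A rho).
Proof.
move=> y; apply: (@cvg_free_energy _ (nbhs y) (nbhs_filter y) rho id y) => i.
exact: coord_continuous.
Qed.

(** A bound on the difference of two free energies that does not depend on the point
of the cube, where coordinates are at most 1 and entropies at most ln 2 in absolute
value. *)
Definition free_energy_gap rho g : R :=
  \sum_i \sum_j `|A i j| * `|rho i * rho j - g i * g j| +
  \sum_i `|rho i - g i| * ln 2.

Lemma free_energy_dist rho g y : cube y ->
  `|free_energy A rho y - free_energy A g y| <= free_energy_gap rho g.
Proof.
move=> yc; have y1 i : `|y i 0| <= 1 by rewrite ler_norml.
rewrite /free_energy; set qr := \sum_i _; set er := \sum_i rho i * coin_entropy _.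
set qg := (X in _ - (_ * X - _)); set eg := (X in _ - (_ - X)).
have -> : 2^-1 * qr - er - (2^-1 * qg - eg) = 2^-1 * (qr - qg) - (er - eg) by ring.
rewrite -!sumrB.
apply: (le_trans (ler_normB _ _)); apply: lerD.
  rewrite normrM [`|2^-1|]ger0_norm//.
  apply: (@le_trans _ _ (1 * _)); first by apply: ler_wpM2r; rewrite ?invf_le1 ?ler1n.
  rewrite mul1r; apply: (le_trans (ler_norm_sum _ _ _)); apply: ler_sum => i _.
  rewrite -sumrB; apply: (le_trans (ler_norm_sum _ _ _)); apply: ler_sum => j _.
  have -> : A i j * (rho i * y i 0) * (rho j * y j 0) - A i j * (g i * y i 0) * (g j * y j 0)
    = A i j * (rho i * rho j - g i * g j) * (y i 0 * y j 0) by ring.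
  by rewrite !normrM -[leRHS]mulr1 ler_wpM2l// ?mulr_ge0// mulr_ile1.
apply: (le_trans (ler_norm_sum _ _ _)); apply: ler_sum => i _.
rewrite -mulrBl normrM ler_wpM2l// ger0_norm ?coin_entropy_ge0//.
exact: coin_entropy_le.
Qed.

Lemma free_energy_uniform_cvg (rho : nat -> 'I_k -> R) g :
  (forall i, rho n i @[n --> \oo] --> g i) ->
  forall e, 0 < e -> \forall n \near \oo, forall y, cube y ->
    `|free_energy A (rho n) y - free_energy A g y| <= e.
Proof.
move=> rg e e0.
have gap0 : free_energy_gap (rho n) g @[n --> \oo] --> 0.
  rewrite (_ : 0 = free_energy_gap g g); last first.
    rewrite /free_energy_gap big1 ?add0r ?big1// => i _.
      by rewrite subrr normr0 mul0r.
    by rewrite big1// => j _; rewrite subrr normr0 mulr0.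
  apply: cvgD; apply: cvg_fsum => i.
    apply: cvg_fsum => j; apply: cvgMr; apply: cvg_norm.
    by apply: cvgB; [exact: cvgM|exact: cvg_cst].
  by apply: cvgMl; apply: cvg_norm; apply: cvgB => //; exact: cvg_cst.
near=> n => y yc; apply: (le_trans (free_energy_dist _ _ yc)).
rewrite (le_trans (ler_norm _))//; near: n.
by apply: cvgr0_norm_le.
Unshelve. all: by end_near. Qed.

(** With all coefficients 0 the free energy vanishes, so [free_energy_dist] bounds it. *)
Lemma free_energy_bounded g : exists M, forall y, cube y -> free_energy A g y <= M.
Proof.
exists (free_energy_gap g (fun=> 0)) => y yc.
have := free_energy_dist g (fun=> 0) yc.
have -> : free_energy A (fun=> 0) y = 0.
  rewrite /free_energy big1 => [|i _]; last by rewrite big1// => j _; ring.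
  by rewrite mulr0 big1 ?subrr// => i _; rewrite mul0r.
by rewrite subr0; apply: le_trans; exact: ler_norm.
Qed.
End free_energy_topology.

(** * Exponential growth of the weight of a set *)

Section approximation.
Context {R : realType}.

(** The number of up spins, among b, whose mean is closest to y from below. *)
Definition nearest_count (b : nat) (y : R) : nat :=
  Num.truncn (b%:R * ((1 + y) / 2)).

Lemma nearest_count_le b y : -1 <= y <= 1 -> (nearest_count b y <= b)%N.
Proof.
move=> /andP[y1 y2]; rewrite -(ler_nat R).
have y0 : 0 <= (1 + y) / 2 <= 1 by lra.
have [y0l y0r] := andP y0.
have /truncn_itv/andP[+ _] : 0 <= b%:R * ((1 + y) / 2) :> R by rewrite mulr_ge0.
by move=> /le_trans; apply; rewrite ler_piMr.
Qed.

Lemma updown_nearest_count b y : (0 < b)%N -> -1 <= y <= 1 ->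
  `|updown b (nearest_count b y) - y| <= 2 / b%:R.
Proof.
move=> b0 yc; have jb := nearest_count_le b yc.
move: yc => /andP[y1 y2].
have bp : 0 < b%:R :> R by rewrite ltr0n.
have /truncn_itv : 0 <= b%:R * ((1 + y) / 2) :> R by rewrite mulr_ge0//; lra.
rewrite -/(nearest_count b y) -[(nearest_count b y).+1]addn1 natrD => /andP[h1 h2].
have -> : updown b (nearest_count b y) - y =
    ((nearest_count b y)%:R - b%:R * ((1 + y) / 2)) * (2 / b%:R).
  by rewrite /updown natrB//; field; rewrite gt_eqF.
rewrite normrM [X in _ * X]ger0_norm ?divr_ge0// ler_piMl ?divr_ge0//.
by rewrite ler_norml; lra.
Qed.

End approximation.

Section mass_asymptotics.
Context {R : realType} {k : nat} (A : 'M[R]_k).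
Context (N : nat -> nat) (B : forall n, 'I_k -> {set 'I_(N n)}).
Context (h : forall n, 'I_(N n) -> 'I_k) (gamma : 'I_k -> R).
Hypotheses (k_gt0 : (0 < k)%N) (N_incr : {homo N : m n / (m < n)%N}).
Hypotheses (B_partition : forall n, block_partition (B n)).
Hypotheses (h_index : forall n, block_index (B n) (@h n)).
Hypotheses (gamma_lim : forall i : 'I_k,
  (fun n => Num.sqrt (#|B n i|%:R / (N n)%:R) : R) @ \oo --> gamma i).
Hypotheses (gamma_gt0 : forall i, 0 < gamma i).

Let Gam i : R := gamma i ^+ 2.
Let massn n (S : set 'cV[R]_k) : R := mass A (B n) (@h n) S.

Lemma system_size_gt0 n : (0 < N n)%N.
Proof.
apply: (leq_trans (block_gt0 (B_partition n) (Ordinal k_gt0))).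
exact: block_le.
Qed.

Lemma system_size_ge n : (n <= N n)%N.
Proof. by elim: n => // n /leq_ltn_trans; apply; exact: N_incr. Qed.

Lemma system_size_ger (M : R) : \forall n \near \oo, M <= (N n)%:R.
Proof.
near=> n; apply: (@le_trans _ _ n%:R); last by rewrite ler_nat system_size_ge.
by near: n; exact: nbhs_infty_ger.
Unshelve. all: by end_near. Qed.

Lemma frequency_cvg i : frequency (B n) i @[n --> \oo] --> Gam i.
Proof.
rewrite (_ : (fun n => frequency (B n) i) = (fun n =>
    Num.sqrt (#|B n i|%:R / (N n)%:R) * Num.sqrt (#|B n i|%:R / (N n)%:R))).
  by rewrite /Gam expr2; apply: cvgM; exact: gamma_lim.
by apply/funext => n; rewrite -expr2 sqr_sqrtr// divr_ge0.
Qed.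

Lemma block_size_ger i (M : R) : \forall n \near \oo, M <= #|B n i|%:R.
Proof.
have g0 : 0 < Gam i by rewrite exprn_gt0.
near=> n.
have hf : Gam i / 2 <= frequency (B n) i.
  near: n; apply: (cvgr_ge (Gam i) (@frequency_cvg i)).
  by rewrite ltr_pdivrMr// ltr_pMr// ltr1n.
have hN : `|M| / (Gam i / 2) <= (N n)%:R by near: n; exact: system_size_ger.
apply: (le_trans (ler_norm _)).
have -> : #|B n i|%:R = (N n)%:R * frequency (B n) i :> R.
  by rewrite /frequency mulrCA divff ?mulr1// pnatr_eq0 -lt0n system_size_gt0.
rewrite -[leLHS](@divfK _ (Gam i / 2)) ?gt_eqF ?divr_gt0//.
by apply: ler_pM; rewrite ?divr_ge0// ?divr_ge0// ltW.
Unshelve. all: by end_near. Qed.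

(** The number of types is subexponential: with x = N e / k, exp x is at least
1 + x^2 / 2, which exceeds 1 + N once N is large. *)
Lemma poly_le_exp (e : R) : 0 < e ->
  \forall n \near \oo, (N n).+1%:R ^+ k <= expR ((N n)%:R * e).
Proof.
move=> e0; have c0 : 0 < e / k%:R by rewrite divr_gt0// ltr0n.
near=> n; set x := (N n)%:R * (e / k%:R).
have -> : (N n)%:R * e = k%:R * x.
  by rewrite /x mulrCA [k%:R * _]mulrC divfK// pnatr_eq0 -lt0n.
rewrite expRM_natl ler_pXn2r ?nnegrE ?expR_ge0//.
apply: (le_trans _ (@expR_ge1Dxn _ x 1 _)); last by rewrite mulr_ge0// ltW.
rewrite -natr1 addrC lerD2l.
have hN : 2 / (e / k%:R) ^+ 2 <= (N n)%:R by near: n; exact: system_size_ger.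
rewrite (_ : x ^+ 2 / _ = (N n)%:R * ((N n)%:R * (e / k%:R) ^+ 2 / 2)).
  by rewrite ler_peMr// ler_pdivlMr// mul1r -ler_pdivrMr ?exprn_gt0.
by rewrite /x exprMn expr2 !mulrA.
Unshelve. all: by end_near. Qed.

(** Uniform convergence transfers the bound r from the limit to the free energy at
volume n, and the number of types is absorbed in the other half of e. *)
Lemma mass_upper (S : set 'cV[R]_k) (r e : R) : 0 < e ->
  (forall y, S y -> cube y -> free_energy A Gam y <= r) ->
  \forall n \near \oo, massn n S <= expR ((N n)%:R * (ln 2 + r + e)).
Proof.
move=> e0 Sr; have e20 : 0 < e / 2 by rewrite divr_gt0.
near=> n.
have hp : (N n).+1%:R ^+ k <= expR ((N n)%:R * (e / 2)).
  by near: n; exact: poly_le_exp.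
have hu : forall y, cube y ->
    `|free_energy A (frequency (B n)) y - free_energy A Gam y| <= e / 2.
  by near: n; apply: free_energy_uniform_cvg => //; exact: frequency_cvg.
apply: (@le_trans _ _ ((N n).+1%:R ^+ k * expR ((N n)%:R * (ln 2 + (r + e / 2))))).
  apply: mass_le => //; first exact: system_size_gt0.
  move=> y Sy yc; have := hu y yc; rewrite ler_norml => /andP[_].
  by have := Sr y Sy yc; lra.
apply: (le_trans (ler_wpM2r (expR_ge0 _) hp)).
rewrite -expRD -mulrDr ler_expR ler_wpM2l//; lra.
Unshelve. all: by end_near. Qed.

(** The types nearest to y converge to y, hence eventually lie in S, and their free
energy converges to that of y. The three thirds of e pay for the polynomial factor,
for the change of coefficients and for the change of point. *)
Lemma mass_lower (S : set 'cV[R]_k) y (e : R) : 0 < e -> cube y -> S° y ->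
  \forall n \near \oo, expR ((N n)%:R * (ln 2 + free_energy A Gam y - e)) <= massn n S.
Proof.
move=> e0 yc Sy; have e30 : 0 < e / 3 by rewrite divr_gt0.
pose j n i := nearest_count #|B n i| (y i 0).
have jB n i : (j n i <= #|B n i|)%N by exact: nearest_count_le.
have prof_cvg i : (profile (B n) (j n) : 'cV[R]_k) i 0 @[n --> \oo] --> y i 0.
  apply/cvgrPdist_le => d d0; near=> n; rewrite mxE distrC.
  apply: (le_trans (updown_nearest_count _ (yc i))).
    exact: block_gt0 (B_partition n) i.
  rewrite ler_pdivrMr ?ltr0n ?(block_gt0 (B_partition n) i)//.
  rewrite mulrC -ler_pdivrMr//; near: n; exact: block_size_ger.
have prof_S : \forall n \near \oo, S (profile (B n) (j n)).
  move: Sy => /nbhs_ballP[d d0 dS].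
  have : \forall n \near \oo, forall i, ball (y i 0) d (profile (B n) (j n) i 0).
    by apply: filter_forall => i; move/cvg_ballP: (@prof_cvg i); exact.
  by apply: filterS => n yn; apply: dS; split=> // i l; rewrite (ord1 l).
near=> n.
have hp : (N n).+1%:R ^+ k <= expR ((N n)%:R * (e / 3)).
  by near: n; exact: poly_le_exp.
have hu : forall y, cube y ->
    `|free_energy A (frequency (B n)) y - free_energy A Gam y| <= e / 3.
  by near: n; apply: free_energy_uniform_cvg => //; exact: frequency_cvg.
have hc : `|free_energy A Gam y - free_energy A Gam (profile (B n) (j n))| <= e / 3.
  near: n; move: e30; move: (e / 3); apply/cvgrPdist_le.
  exact: cvg_free_energy.
have hS : S (profile (B n) (j n)) by near: n.
have hf : free_energy A Gam y - e + e / 3 <=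
    free_energy A (frequency (B n)) (profile (B n) (j n)).
  have := hu _ (profile_cube (jB n)); move: hc.
  by rewrite !ler_norml => /andP[_ h1] /andP[h2 _]; lra.
rewrite -(ler_pM2l (expR_gt0 ((N n)%:R * (e / 3)))) -expRD -mulrDr.
apply: (@le_trans _ _ (expR ((N n)%:R * (ln 2 +
    free_energy A (frequency (B n)) (profile (B n) (j n)))))).
  by rewrite ler_expR ler_wpM2l//; lra.
apply: (le_trans (mass_ge _ (B_partition n) (@h_index n) (system_size_gt0 n) (jB n) hS)).
by rewrite ler_wpM2r// sumr_ge0// => x _; exact: expR_ge0.
Unshelve. all: by end_near. Qed.
(** The normalizing constant is bounded below at a near-maximizer of the free energy. *)
Lemma probability_upper (S : set 'cV[R]_k) (m c e : R) : 0 < e ->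
  (forall d : R, 0 < d -> exists2 y, cube y & m - d < free_energy A Gam y) ->
  (forall y, S y -> cube y -> free_energy A Gam y <= c) ->
  \forall n \near \oo,
    massn n S / massn n setT <= expR ((N n)%:R * (c - m + e)).
Proof.
move=> e0 I_near Sc; have e30 : 0 < e / 3 by rewrite divr_gt0.
have [y yc Iy] := I_near _ e30.
have yT : (setT : set 'cV[R]_k)° y by rewrite interiorT.
near=> n.
have up : massn n S <= expR ((N n)%:R * (ln 2 + c + e / 3)) by near: n; exact: mass_upper.
have lo : expR ((N n)%:R * (ln 2 + free_energy A Gam y - e / 3)) <= massn n setT.
  by near: n; exact: mass_lower.
rewrite ler_pdivrMr; last exact: lt_le_trans (expR_gt0 _) lo.
apply: (le_trans up); apply: le_trans (ler_wpM2l (expR_ge0 _) lo).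
by rewrite -expRD -mulrDr ler_expR ler_wpM2l//; lra.
Unshelve. all: by end_near. Qed.

Lemma probability_lower (S : set 'cV[R]_k) y (m e : R) : 0 < e ->
  (forall z, cube z -> free_energy A Gam z <= m) -> cube y -> S° y ->
  \forall n \near \oo,
    expR ((N n)%:R * (free_energy A Gam y - m - e)) <= massn n S / massn n setT.
Proof.
move=> e0 I_le yc Sy; have e20 : 0 < e / 2 by rewrite divr_gt0.
have yT : (setT : set 'cV[R]_k)° y by rewrite interiorT.
near=> n.
have up : massn n setT <= expR ((N n)%:R * (ln 2 + m + e / 2)).
  by near: n; apply: mass_upper => // z _; exact: I_le.
have lo : expR ((N n)%:R * (ln 2 + free_energy A Gam y - e / 2)) <= massn n S.
  by near: n; exact: mass_lower.
have loT : expR ((N n)%:R * (ln 2 + free_energy A Gam y - e / 2)) <= massn n setT.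
  by near: n; exact: mass_lower.
rewrite ler_pdivlMr; last exact: lt_le_trans (expR_gt0 _) loT.
apply: le_trans lo; apply: (le_trans (ler_wpM2l (expR_ge0 _) up)).
by rewrite -expRD -mulrDr ler_expR ler_wpM2l//; lra.
Unshelve. all: by end_near. Qed.

End mass_asymptotics.

(** * Superior and inferior limits of log-probabilities *)

Section limits_of_log_probabilities.
Context {R : realType}.
Local Open Scope ereal_scope.

Lemma limn_esup_le (u : (\bar R)^nat) l :
  (\forall n \near \oo, u n <= l) -> limn_esup u <= l.
Proof.
move=> ul; rewrite /limn_esup limf_esupE.
apply: (@le_trans _ _ (ereal_sup (u @` [set n | u n <= l])%classic)).
  by apply: ereal_inf_lbound; exists [set n | u n <= l]%classic.
by apply: ge_ereal_sup => _ [n un <-].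
Qed.

Lemma limn_einf_ge (u : (\bar R)^nat) l :
  (\forall n \near \oo, l <= u n) -> l <= limn_einf u.
Proof.
move=> lu; rewrite /limn_einf leeNr; apply: limn_esup_le.
by apply: filterS lu => n; rewrite leeN2.
Qed.

Lemma scaled_lne_le (m c p : R) : (0 < m)%R -> (0 <= p)%R ->
  (p <= expR (m * c))%R -> lne p%:E * (m^-1)%:E <= c%:E.
Proof.
move=> m0; rewrite le_eqVlt => /predU1P[<- _|p0 pe].
  by rewrite le0_lneNy// gt0_mulNye ?leNye// lte_fin invr_gt0.
rewrite lne_EFin// -EFinM lee_fin ler_pdivrMr// mulrC -[leRHS]expRK.
by rewrite ler_ln ?posrE ?expR_gt0.
Qed.

Lemma scaled_lne_ge (m c p : R) : (0 < m)%R -> (expR (m * c) <= p)%R ->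
  c%:E <= lne p%:E * (m^-1)%:E.
Proof.
move=> m0 pe; have p0 : (0 < p)%R by apply: lt_le_trans pe; exact: expR_gt0.
rewrite lne_EFin// -EFinM lee_fin ler_pdivlMr// mulrC -[leLHS]expRK.
by rewrite ler_ln ?posrE ?expR_gt0.
Qed.
End limits_of_log_probabilities.

Section gibbs_mass.
Context {R : realType} {k N : nat} (A : 'M[R]_k).
Context (B : 'I_k -> {set 'I_N}) (h : 'I_N -> 'I_k).

Lemma mass_ge0 (S : set 'cV[R]_k) : 0 <= mass A B h S.
Proof. by apply: sumr_ge0 => x _; exact: expR_ge0. Qed.

Lemma partition_function_mass :
  partition_function (block_coupling A h) = mass A B h setT.
Proof. by apply: eq_bigl => x; rewrite in_setT. Qed.

Lemma distribution_mass (S : set (borel 'cV[R]_k)) :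
  distribution (gibbs (block_coupling A h)) (magnetization B) S =
  (mass A B h S / mass A B h setT)%:E.
Proof.
rewrite /distribution /pushforward/= /gibbs -partition_function_mass.
rewrite /mass mulr_suml -sumEFin [RHS]big_mkcond/=; apply: eq_bigr => x _.
rewrite diracE; have [xS|xS] := boolP (magnetization B x \in S).
  by rewrite mem_set ?mule1//; exact: set_mem xS.
rewrite memNset ?mule0//; move: xS; rewrite notin_setE; exact.
Qed.
End gibbs_mass.

(** * The rate function *)

Section rate_function.
Context {R : realType} {k : nat} (A : 'M[R]_k) (gamma : 'I_k -> R).
Hypothesis gamma_gt0 : forall i, 0 < gamma i.
Implicit Type y : 'cV[R]_k.

Let I := free_energy A (fun i => gamma i ^+ 2).

Lemma quadratic_form_blocks y (G := diag_mx (\row_i gamma i)) :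
  dot y (G ^+ 2 *m A *m G ^+ 2 *m y) =
  \sum_i \sum_j A i j * (gamma i ^+ 2 * y i 0) * (gamma j ^+ 2 * y j 0).
Proof.
have GG : G ^+ 2 = diag_mx (\row_i gamma i ^+ 2).
  rewrite expr2 [LHS]mulmx_diag; congr diag_mx.
  by apply/rowP => i; rewrite !mxE expr2.
rewrite GG /dot; apply: eq_bigr => i _.
rewrite -!mulmxA mul_diag_mx !mxE !mulr_sumr; apply: eq_bigr => j _.
by rewrite mul_diag_mx !mxE; ring.
Qed.

Lemma Ifun_cube y : cube y -> Ifun A gamma y = (I y)%:E.
Proof.
move=> yc; rewrite /Ifun quadratic_form_blocks.
rewrite (eq_bigr (fun i => (gamma i ^+ 2 * coin_entropy (y i 0))%:E)).
  by rewrite sumEFin -EFinB.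
by move=> i _; rewrite Lstar_coin_entropy.
Qed.

Lemma Ifun_notin_cube y : ~ cube y -> Ifun A gamma y = -oo%E.
Proof.
move=> /existsNP[i /negP yi]; rewrite /Ifun.
have -> : (\sum_(i < k) (gamma i ^+ 2)%:E * Lstar (y i ord0) = +oo)%E.
  have Lge0 j : (0 <= Lstar (y j ord0))%E.
    have [yj|/Lstar_pinfty ->//] := boolP (-1 <= y j ord0 <= 1).
    by rewrite Lstar_coin_entropy// lee_fin coin_entropy_ge0.
  apply/eqP; rewrite esum_eqy => [|j _]; last first.
    by rewrite gt_eqF// (lt_le_trans ltNy0)// mule_ge0// lee_fin sqr_ge0.
  apply/existsP; exists i => /=.
  by rewrite Lstar_pinfty// gt0_muley// lte_fin exprn_gt0.
by [].
Qed.

Lemma cube0 : cube (0 : 'cV[R]_k).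
Proof. by move=> i; rewrite mxE; lra. Qed.

Lemma sup_free_energy : exists m, [/\ ereal_sup (range (Ifun A gamma)) = m%:E,
  forall y, cube y -> I y <= m &
  forall e, 0 < e -> exists2 y, cube y & m - e < I y].
Proof.
have [M IM] := free_energy_bounded A (fun i => gamma i ^+ 2).
set s := ereal_sup _.
have sge y : cube y -> ((I y)%:E <= s)%E.
  by move=> yc; rewrite -Ifun_cube//; apply: ereal_sup_ubound; exists y.
have sM : (s <= M%:E)%E.
  apply: ge_ereal_sup => _ [y _ <-].
  have [yc|yc] := pselect (cube y); last by rewrite Ifun_notin_cube// leNye.
  by rewrite Ifun_cube// lee_fin IM.
have sfin : s \is a fin_num.
  rewrite fin_numElt (le_lt_trans sM (ltry _)) andbT.
  by rewrite (lt_le_trans (ltNyr _) (sge _ cube0)).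
exists (fine s); split; first by rewrite fineK.
  by move=> y /sge; rewrite -[X in (_ <= X)%E](fineK sfin) lee_fin.
move=> e e0; have [_ [y _ <-]] := ub_ereal_sup_adherent e0 sfin.
have [yc|yc] := pselect (cube y); last by rewrite Ifun_notin_cube// ltNge leNye.
rewrite Ifun_cube// -/s -(fineK sfin) -EFinB lte_fin => he.
by exists y.
Qed.

Lemma closed_cube : closed (cube : set 'cV[R]_k).
Proof.
rewrite (_ : cube = \bigcap_(i in [set: 'I_k])
    ((fun y : 'cV[R]_k => y i 0) @^-1` `[-1, 1]%classic)).
  apply: closed_bigI => i _; apply: closed_comp => [y _|]; first exact: coord_continuous.
  exact: itv_closed.
by apply/seteqP; split=> y /= yc i => [_|]; have := yc i; rewrite /= in_itv/=; apply.
Qed.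

(** The cube is the image of a product of segments under transposition, which is
continuous. *)
Lemma compact_cube : compact (cube : set 'cV[R]_k).
Proof.
have cK : compact [set v : 'rV[R]_k | forall i, v ord0 i \in `[-1, 1]].
  apply: (@rV_compact R _ (fun=> `[(-1 : R), 1]%classic)).
  by move=> _; exact: segment_compact.
have -> : cube = trmx @` [set v : 'rV[R]_k | forall i, v ord0 i \in `[-1, 1]].
  apply/seteqP; split=> [y yc|_ [v vc <-] i].
    exists y^T; last by rewrite trmxK.
    by move=> i; rewrite in_itv/= mxE; exact: yc.
  by have := vc i; rewrite mxE in_itv.
apply: continuous_compact cK.
apply: continuous_subspaceT => v P /nbhs_ballP[e e0 eP].
apply/nbhs_ballP; exists e => // w [_ vw]; apply: eP; split=> // i j.
by rewrite !mxE.
Qed.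

(** On the cube the rate function agrees with a function continuous on the whole
space, and off the cube it is +oo: around a point of the cube, a neighbourhood
on which the continuous function exceeds a is one on which the rate function does.
The complement of the cube is open, which settles the other points. *)
Lemma Jfun_rate_function : rate_function (Jfun A gamma).
Proof.
have [m [mE Im _]] := sup_free_energy.
have Jcube y : cube y -> Jfun A gamma y = (m - I y)%:E.
  by move=> yc; rewrite /Jfun mE Ifun_cube.
have Jout y : ~ cube y -> Jfun A gamma y = +oo%E.
  by move=> yc; rewrite /Jfun mE Ifun_notin_cube.
have lscJ : lower_semicontinuous (Jfun A gamma).
  move=> y a ay; have [yc|yc] := pselect (cube y); last first.
    exists (~` cube); last by move=> z zc; rewrite Jout// ltry.
    by apply: open_nbhs_nbhs; split=> //; apply: closed_openC; exact: closed_cube.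
  exists [set z | I z < m - a]; last first.
    move=> z /= Iz; have [zc|zc] := pselect (cube z); last by rewrite Jout// ltry.
    by rewrite Jcube// lte_fin; lra.
  have Icont : I z @[z --> nbhs y] --> I y by exact: continuous_free_energy.
  apply: (@cvgr_lt R _ (nbhs y) (nbhs_filter y) I (I y) Icont).
  by move: ay; rewrite Jcube// lte_fin; lra.
split=> // L _; apply: subclosed_compact compact_cube _; last first.
  move=> y /= yL; apply: contrapT => yc; move: yL; by rewrite Jout// leye_eq.
rewrite (_ : [set _ | _] = ~` [set y | (L%:E < Jfun A gamma y)%E]).
  by apply: open_closedC; have /lower_semicontinuousP := lscJ; exact.
by apply/seteqP; split=> y /=; rewrite leNgt => /negP.
Qed.
End rate_function.

(** * The large deviation principle *)

Theorem theorem1p1 (R : realType) (k : nat) (A : 'M[R]_k)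
    (N : nat -> nat) (B : forall n, 'I_k -> {set 'I_(N n)})
    (h : forall n, 'I_(N n) -> 'I_k) (gamma : 'I_k -> R)
    (k_gt0 : (0 < k)%N)
    (A_sym : A^T = A)
    (A_posdef : posdefmx A)
    (N_incr : {homo N : m n / (m < n)%N})
    (B_partition : forall n, block_partition (B n))
    (h_index : forall n, block_index (B n) (h n))
    (gamma_lim : forall i : 'I_k,
       (fun n => Num.sqrt (#|B n i|%:R / (N n)%:R) : R) @ \oo --> gamma i)
    (gamma_itv : forall i : 'I_k, 0 < gamma i < 1) :
  (forall x : R, -1 <= x <= 1 ->
     Lstar x = (2^-1 * (1 + x) * ln (1 + x) +
                2^-1 * (1 - x) * ln (1 - x))%:E) /\
  LDP_under (fun n => gibbs (block_coupling A (h n)))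
    (fun n => magnetization (B n))
    (fun n => (N n)%:R) (Jfun A gamma).
Proof.
split=> [x x1|]; first by rewrite Lstar_coin_entropy// coin_entropyE.
have gamma_gt0 i : 0 < gamma i by have /andP[] := gamma_itv i.
split; first exact: Jfun_rate_function.
move=> S _.
have [m [mE Im m_near]] := sup_free_energy A gamma_gt0.
have Jcube y : cube y -> Jfun A gamma y =
    (m - free_energy A (fun i => gamma i ^+ 2) y)%:E.
  by move=> yc; rewrite /Jfun mE Ifun_cube.
have Jout y : ~ cube y -> Jfun A gamma y = +oo%E.
  by move=> yc; rewrite /Jfun mE Ifun_notin_cube.
have N0 n : 0 < (N n)%:R :> R.
  by rewrite ltr0n (system_size_gt0 k_gt0 B_partition).
set u := (fun n => _).
have uE n : u n = (lne (mass A (B n) (h n) S / mass A (B n) (h n) setT)%:E *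
    ((N n)%:R^-1)%:E)%E.
  by congr (lne _ * _)%E; exact: distribution_mass.
split; last 1 first.
(* The upper bound comes from every real c below the infimum of the rate function,
   which also covers an infinite infimum. *)
- have step c : (c%:E <= ereal_inf [set Jfun A gamma y | y in closure S])%E ->
      (limn_esup u <= (- c)%:E)%E.
    move=> cJ; apply/lee_addgt0Pr => e e0; apply: limn_esup_le.
    have Sc y : S y -> cube y ->
        free_energy A (fun i => gamma i ^+ 2) y <= m - c.
      move=> Sy yc; have : (c%:E <= Jfun A gamma y)%E.
        apply: (le_trans cJ); apply: ereal_inf_lbound; exists y => //.
        exact: subset_closure.
      by rewrite Jcube// lee_fin; lra.
    have := probability_upper k_gt0 N_incr B_partition h_index gamma_lim
      gamma_gt0 e0 m_near Sc.
    apply: filterS => n pn; rewrite uE -EFinD; apply: scaled_lne_le => //.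
      by rewrite divr_ge0// mass_ge0.
    apply: (le_trans pn); rewrite ler_expR ler_wpM2l//; lra.
  move: step; case: (ereal_inf _) => [c||].
  + by apply.
  + move=> step; rewrite leeNy_eq; apply/eqP/eq_ninfty => c.
    by rewrite -[c]opprK step// leey.
  + by move=> _; rewrite leey.
- rewrite leeNl; apply: le_ereal_inf_tmp => _ [y yS <-].
  have [yc|yc] := pselect (cube y); last by rewrite Jout// leey.
  rewrite leeNl Jcube//; apply/lee_addgt0Pr => e e0; rewrite -leeBlDr//.
  apply: limn_einf_ge.
  have := probability_lower k_gt0 N_incr B_partition h_index gamma_lim
    gamma_gt0 e0 Im yc yS.
  apply: filterS => n pn; rewrite uE -EFinN -EFinB; apply: scaled_lne_ge => //.
  by apply: le_trans pn; rewrite ler_expR ler_wpM2l//; lra.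
- exact: limn_einf_sup.
Qed.
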